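(* Consider the Ehrhard-Müller system $$\dot x=s(y-x),\quad \dot y=rx-xz-y+c,\quad \dot z=xy-z,$$ with real parameters $s,r,c$ and $(x,y,z)\in\mathbb{R}^3$. Up to multiplication of $f$ by a nonzero real constant, all the invariant algebraic surfaces $f(x,y,z)=0$ of degree $2$ of this system, together with their cofactors $k$, are the following: (a) $s=1/2$: $f=x^2-z$, with $k=-1$; (b) $s=2$, $r=0$: $f=y^2+z^2-cx$, with $k=-2$; (c) $r=0$, $c=0$: $f=y^2+z^2$, with $k=-2$; (d) $s=1$, $c=0$: $f=y^2+z^2-rx^2$, with $k=-2$.
   Context: Let $X=s(y-x)\,\partial_x+(rx-xz-y+c)\,\partial_y+(xy-z)\,\partial_z$ be the vector field associated with the system. For a real polynomial $f=f(x,y,z)$, the set $f=0$ is called an invariant algebraic surface of the system if $Xf=kf$ for some real polynomial $k=k(x,y,z)$ of degree at most $1$, called the cofactor of $f$. The degree of the surface is the degree of the polynomial $f$. (The zero set of $f$ may be of lower dimension, as in case (c).) Parameters not mentioned in a case are arbitrary real numbers.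
   Formalization: The degenerate case s=0 with cofactor k=0 is excluded: there x is a first integral, so every quadratic polynomial in x alone, such as x^2, is invariant of degree 2 but not on the list. *)

(* Defs.v *)
From HB Require Import structures.
From mathcomp Require Import all_boot all_order all_algebra.
From mathcomp Require Export reals.
From mathcomp Require Export mpoly.

Set Implicit Arguments.
Unset Strict Implicit.
Unset Printing Implicit Defensive.

Import GRing.Theory.
Local Open Scope ring_scope.

Section EhrhardMuller.
Variable R : realType.
Implicit Types f k : {mpoly R[3]}.

Definition ix : 'I_3 := @Ordinal 3 0 isT.
Definition iy : 'I_3 := @Ordinal 3 1 isT.
Definition iz : 'I_3 := @Ordinal 3 2 isT.

Definition x_ : {mpoly R[3]} := 'X_ix.
Definition y_ : {mpoly R[3]} := 'X_iy.
Definition z_ : {mpoly R[3]} := 'X_iz.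

(* [msize f] is the total degree of [f] plus one, and 0 if [f] is zero; the zero
   polynomial thus gets degree 0. *)
Definition degree f : nat := (msize f).-1.

Definition EM_field (s r c : R) f : {mpoly R[3]} :=
  s *: (y_ - x_) * f^`M(ix)
  + (r *: x_ - x_ * z_ - y_ + c%:MP) * f^`M(iy)
  + (x_ * y_ - z_) * f^`M(iz).

Definition invariant_surface_with_cofactor (s r c : R) f k : Prop :=
  (degree k <= 1)%N /\ EM_field s r c f = k * f.

End EhrhardMuller.

Arguments x_ {R}.
Arguments y_ {R}.
Arguments z_ {R}.

(* Main.v *)
(* Compare coefficients in X f = k f. The leading part of X is x times the
   rotation y d/dz - z d/dy, which has no nonzero real eigenvalue, so degree 3
   forces k to be constant and the quadratic part of f to be
   a (y^2 + z^2) + b x^2. The equations of lower degree then leave the four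
   families, a = 0 giving the first one. *)
Require Import Defs.
From mathcomp Require Import all_boot all_order all_algebra.
From mathcomp Require Import ring lra zify.

Set Implicit Arguments.
Unset Strict Implicit.
Unset Printing Implicit Defensive.

Import Order.TTheory GRing.Theory Num.Theory.
Local Open Scope ring_scope.

(** * Coefficients of polynomials in any number of variables *)

Section MonomialCoefficients.
Variables (n : nat) (A : comNzRingType).
Implicit Types p : {mpoly A[n]}.

(** Subtraction of multi-indices is truncated, so [m - U_(i)] is the true quotient only when [m i]
    is positive. When [m i] is zero, [m] lies outside the support of a multiple of ['X_i]. *)
Lemma mcoeffXiM (i : 'I_n) p (m : 'X_{1..n}) :
  ('X_i * p)@_m = if m i == 0%N then 0 else p@_(m - U_(i)).
Proof.
case: eqP => [mi0|/eqP mi0]; last first.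
  have le_im : (U_(i) <= m)%MM.
    apply/mnm_lepP => j; rewrite mnm1E; case: eqP => // <-.
    by rewrite lt0n.
  by rewrite -{1}(submK le_im) addmC mulrC mcoeffMX.
apply: memN_msupp_eq0; rewrite mulrC (perm_mem (msuppMX p U_(i)%MM)).
by apply/mapP => -[m' _ mE]; move: mi0; rewrite mE mnmDE mnm1E eqxx.
Qed.

Lemma mderivXi (i j : 'I_n) : ('X_j : {mpoly A[n]})^`M(i) = (j == i)%:R.
Proof.
rewrite mderivX mnm1E; case: eqP => [->|_]; last by rewrite scale0r.
rewrite (_ : U_(i) - U_(i) = 0)%MM ?mpolyX0 ?scale1r //.
by apply/mnmP => l; rewrite mnmBE subnn mnm0E.
Qed.

Lemma msize_leP p d :
  reflect (forall m, (d <= mdeg m)%N -> p@_m = 0) (msize p <= d)%N.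
Proof.
apply: (iffP idP) => [le_pd m le_dm|p0].
  exact/memN_msupp_eq0/msize_mdeg_ge/(leq_trans le_pd).
rewrite msizeE; apply/bigmax_leqP_seq => m m_p _; rewrite ltnNge.
by apply/negP => /p0 /eqP; rewrite mcoeff_eq0 m_p.
Qed.

End MonomialCoefficients.

(** * Monomials and coefficients in three variables *)

(** With the exponents explicit, coefficient formulas become case analyses on natural numbers, which
    reduce by computation. *)
Definition mon3 (a b c : nat) : 'X_{1..3} := [multinom of [:: a; b; c]].

Lemma forall_I3 (P : 'I_3 -> Prop) : P ix -> P iy -> P iz -> forall i, P i.
Proof.
move=> Px Py Pz [[|[|[|//]]] lti].
- by rewrite (_ : Ordinal lti = ix) //; apply: val_inj.
- by rewrite (_ : Ordinal lti = iy) //; apply: val_inj.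
- by rewrite (_ : Ordinal lti = iz) //; apply: val_inj.
Qed.

Lemma mon3E (m : 'X_{1..3}) : m = mon3 (m ix) (m iy) (m iz).
Proof. by apply/mnmP; apply: forall_I3. Qed.

Lemma mdeg_mon3 a b c : mdeg (mon3 a b c) = (a + b + c)%N.
Proof. by rewrite /mdeg /= !big_cons big_nil addn0 addnA. Qed.

Lemma eq_mon3 a b c a' b' c' :
  (mon3 a b c == mon3 a' b' c') = [&& a == a', b == b' & c == c'].
Proof. by rewrite /mon3 -!val_eqE /= !eqseq_cons andbT. Qed.

Section TrivariateCoefficients.
Variable R : realType.
Implicit Types f k p : {mpoly R[3]}.

Lemma mpolyX_mon3 a b c :
  'X_[mon3 a b c] = x_ ^+ a * y_ ^+ b * z_ ^+ c :> {mpoly R[3]}.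
Proof.
rewrite !mpolyXn -!mpolyXD; congr 'X_[_].
apply/mnmP; apply: forall_I3;
  by rewrite !mnmDE !mulmnE !mnm1E /= ?(mul1n, mul0n, addn0, add0n).
Qed.

Lemma mcoeff_xM p a b c :
  (x_ * p)@_(mon3 a b c) = if a is a'.+1 then p@_(mon3 a' b c) else 0.
Proof.
rewrite mcoeffXiM; case: a => //= a; congr (mcoeff _ p).
by apply/mnmP; apply: forall_I3; rewrite mnmBE mnm1E /= ?subn1 ?subn0.
Qed.

Lemma mcoeff_yM p a b c :
  (y_ * p)@_(mon3 a b c) = if b is b'.+1 then p@_(mon3 a b' c) else 0.
Proof.
rewrite mcoeffXiM; case: b => //= b; congr (mcoeff _ p).
by apply/mnmP; apply: forall_I3; rewrite mnmBE mnm1E /= ?subn1 ?subn0.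
Qed.

Lemma mcoeff_zM p a b c :
  (z_ * p)@_(mon3 a b c) = if c is c'.+1 then p@_(mon3 a b c') else 0.
Proof.
rewrite mcoeffXiM; case: c => //= c; congr (mcoeff _ p).
by apply/mnmP; apply: forall_I3; rewrite mnmBE mnm1E /= ?subn1 ?subn0.
Qed.

Lemma mcoeff_dx p a b c :
  p^`M(ix)@_(mon3 a b c) = p@_(mon3 a.+1 b c) *+ a.+1.
Proof.
rewrite mcoeff_mderiv; congr (mcoeff _ p *+ _).
by apply/mnmP; apply: forall_I3; rewrite mnmDE mnm1E /= ?addn1 ?addn0.
Qed.

Lemma mcoeff_dy p a b c :
  p^`M(iy)@_(mon3 a b c) = p@_(mon3 a b.+1 c) *+ b.+1.
Proof.
rewrite mcoeff_mderiv; congr (mcoeff _ p *+ _).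
by apply/mnmP; apply: forall_I3; rewrite mnmDE mnm1E /= ?addn1 ?addn0.
Qed.

Lemma mcoeff_dz p a b c :
  p^`M(iz)@_(mon3 a b c) = p@_(mon3 a b c.+1) *+ c.+1.
Proof.
rewrite mcoeff_mderiv; congr (mcoeff _ p *+ _).
by apply/mnmP; apply: forall_I3; rewrite mnmDE mnm1E /= ?addn1 ?addn0.
Qed.

Definition mcoeff3E :=
  (mcoeff_xM, mcoeff_yM, mcoeff_zM, mcoeff_dx, mcoeff_dy, mcoeff_dz).

(** * Polynomials of degree at most two and linear cofactors *)

(** The digits in the name of a coefficient are the exponents of x, y and z. The [mon3] form serves
    to read off coefficients, and [quadricE] gives the form on which [ring] computes. *)
Definition quadric (q200 q020 q002 q110 q101 q011 q100 q010 q001 q000 : R) :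
    {mpoly R[3]} :=
  q200 *: 'X_[mon3 2 0 0] + q020 *: 'X_[mon3 0 2 0] + q002 *: 'X_[mon3 0 0 2]
  + q110 *: 'X_[mon3 1 1 0] + q101 *: 'X_[mon3 1 0 1] + q011 *: 'X_[mon3 0 1 1]
  + q100 *: 'X_[mon3 1 0 0] + q010 *: 'X_[mon3 0 1 0] + q001 *: 'X_[mon3 0 0 1]
  + q000 *: 'X_[mon3 0 0 0].

Lemma mcoeff_quadric q200 q020 q002 q110 q101 q011 q100 q010 q001 q000 a b c :
  (quadric q200 q020 q002 q110 q101 q011 q100 q010 q001 q000)@_(mon3 a b c)
  = match a, b, c with
    | 2, 0, 0 => q200 | 0, 2, 0 => q020 | 0, 0, 2 => q002
    | 1, 1, 0 => q110 | 1, 0, 1 => q101 | 0, 1, 1 => q011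
    | 1, 0, 0 => q100 | 0, 1, 0 => q010 | 0, 0, 1 => q001
    | 0, 0, 0 => q000 | _, _, _ => 0%R
    end%N.
Proof.
rewrite /quadric !(mcoeffD, mcoeffZ) !mcoeffX !eq_mon3.
case: a => [|[|[|a]]]; case: b => [|[|[|b]]]; case: c => [|[|[|c]]] /=.
all: rewrite ?mulr0 ?mulr1 ?addr0 ?add0r; reflexivity.
Qed.

Lemma quadricE q200 q020 q002 q110 q101 q011 q100 q010 q001 q000 :
  quadric q200 q020 q002 q110 q101 q011 q100 q010 q001 q000
  = q200 *: x_ ^+ 2 + q020 *: y_ ^+ 2 + q002 *: z_ ^+ 2
    + q110 *: (x_ * y_) + q101 *: (x_ * z_) + q011 *: (y_ * z_)
    + q100 *: x_ + q010 *: y_ + q001 *: z_ + q000%:MP.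
Proof.
rewrite /quadric !mpolyX_mon3 !expr0 !expr1 !mul1r !mulr1.
by rewrite alg_mpolyC.
Qed.

Lemma msize_le3E f : (msize f <= 3)%N ->
  f = quadric f@_(mon3 2 0 0) f@_(mon3 0 2 0) f@_(mon3 0 0 2)
              f@_(mon3 1 1 0) f@_(mon3 1 0 1) f@_(mon3 0 1 1)
              f@_(mon3 1 0 0) f@_(mon3 0 1 0) f@_(mon3 0 0 1) f@_(mon3 0 0 0).
Proof.
move=> /msize_leP f3; apply/mpolyP => m; rewrite (mon3E m).
move: (m ix) (m iy) (m iz) => a b c; have := f3 (mon3 a b c).
rewrite mcoeff_quadric mdeg_mon3 => {f3}.
case: a => [|[|[|a]]]; case: b => [|[|[|b]]]; case: c => [|[|[|c]]];
  solve [move=> _; reflexivity | exact].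
Qed.

Lemma msize_quadric_le q200 q020 q002 q110 q101 q011 q100 q010 q001 q000 :
  (msize (quadric q200 q020 q002 q110 q101 q011 q100 q010 q001 q000) <= 3)%N.
Proof.
apply/msize_leP => m; rewrite (mon3E m) mdeg_mon3 mcoeff_quadric.
by case: (m ix) (m iy) (m iz) => [|[|[|a]]] [|[|[|b]]] [|[|[|c]]].
Qed.

Lemma degree_eq2_msize f : degree f = 2%N -> (msize f <= 3)%N.
Proof. by rewrite /degree; case: (msize f) => //= m ->. Qed.

Lemma degree_eq2_neq0 f : degree f = 2%N ->
  ~ (f@_(mon3 2 0 0) = 0 /\ f@_(mon3 0 2 0) = 0 /\ f@_(mon3 0 0 2) = 0 /\
     f@_(mon3 1 1 0) = 0 /\ f@_(mon3 1 0 1) = 0 /\ f@_(mon3 0 1 1) = 0).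
Proof.
move=> f2 [h1 [h2 [h3 [h4 [h5 h6]]]]]; have f3 := degree_eq2_msize f2.
suff : (msize f <= 2)%N.
  by move: f2; rewrite /degree; case: (msize f) => //= m ->.
apply/msize_leP => m; rewrite (mon3E m) mdeg_mon3.
move: (m ix) (m iy) (m iz) => a b c.
move/msize_leP: f3 => /(_ (mon3 a b c)); rewrite mdeg_mon3.
by case: a => [|[|[|a]]]; case: b => [|[|[|b]]]; case: c => [|[|[|c]]] //= ->.
Qed.

Lemma degree_eq2 f m :
  (msize f <= 3)%N -> mdeg m = 2%N -> f@_m != 0 -> degree f = 2%N.
Proof.
rewrite -mcoeff_msupp /degree => f3 m2 /msize_mdeg_lt; rewrite m2 => f2.
by case: (msize f) f2 f3 => [|[|[|[]]]].
Qed.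

Lemma cofactor_linearE k : (degree k <= 1)%N ->
  k = k@_(mon3 1 0 0) *: x_ + k@_(mon3 0 1 0) *: y_ + k@_(mon3 0 0 1) *: z_
      + (k@_(mon3 0 0 0))%:MP.
Proof.
(* Since [degree] is the truncated predecessor of [msize], the bound also holds for the zero
   cofactor. *)
rewrite /degree => k1; have k2 : (msize k <= 2)%N by move: k1; case: (msize k).
rewrite {1}(msize_le3E (leq_trans k2 _)) // quadricE.
have k0 a b c : (2 <= a + b + c)%N -> k@_(mon3 a b c) = 0.
  by move=> ?; apply: (msize_leP _ _ k2); rewrite mdeg_mon3.
rewrite (k0 2 0 0) // (k0 0 2 0) // (k0 0 0 2) //.
rewrite (k0 1 1 0) // (k0 1 0 1) // (k0 0 1 1) //.
by rewrite !scale0r !add0r.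
Qed.

(** * The equation X f = k f in coefficients, and the two algebraic systems it yields *)

(** Every term is a scalar times variables multiplied one at a time from the left, the shape to
    which the rules [mcoeff3E] apply. *)
Lemma EM_fieldE s r c f :
  EM_field s r c f
  = s *: (y_ * f^`M(ix)) - s *: (x_ * f^`M(ix))
    + (r *: (x_ * f^`M(iy)) - x_ * (z_ * f^`M(iy)) - y_ * f^`M(iy)
       + c *: f^`M(iy))
    + (x_ * (y_ * f^`M(iz)) - z_ * f^`M(iz)).
Proof.
by rewrite /EM_field -!mul_mpolyC; ring.
Qed.

End TrivariateCoefficients.

(* The hypotheses are the coefficients of
   x (y d/dz - z d/dy) q = (u x + v y + w z) q. *)
Lemma rotation_eigenform (R : realFieldType)
    (q200 q020 q002 q110 q101 q011 u v w : R) :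
  ~ (q200 = 0 /\ q020 = 0 /\ q002 = 0 /\ q110 = 0 /\ q101 = 0 /\ q011 = 0) ->
  0 = u * q200 ->
  0 = v * q020 ->
  0 = w * q002 ->
  q101 = u * q110 + v * q200 ->
  - q110 = u * q101 + w * q200 ->
  q011 = u * q020 + v * q110 ->
  - q011 = u * q002 + w * q101 ->
  0 = v * q011 + w * q020 ->
  0 = v * q002 + w * q011 ->
  q002 *+ 2 - q020 *+ 2 = u * q011 + v * q101 + w * q110 ->
  [/\ u = 0, v = 0, w = 0, q002 = q020 & [/\ q110 = 0, q101 = 0 & q011 = 0]].
Proof.
move=> q_neq0 e300 e030 e003 e210 e201 e120 e102 e021 e012 e111.
(* For v nonzero the equations are triangular: those of y^3, y^2 z, y z^2, x y^2, x y z and x^2 y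
   annihilate q020, q011, q002, q110, q101 and q200 in turn, against [q_neq0]. A nonzero w is
   excluded in the same manner, starting from z^3. *)
have v0 : v = 0.
  have [//|v_neq0] := eqVneq v 0; have vI := mulfI v_neq0.
  have q020_0 : q020 = 0 by apply: vI; lra.
  have q011_0 : q011 = 0 by apply: vI; nra.
  have q002_0 : q002 = 0 by apply: vI; nra.
  have q110_0 : q110 = 0 by apply: vI; nra.
  have q101_0 : q101 = 0 by apply: vI; nra.
  by case: q_neq0; do !split => //; apply: vI; nra.
have w0 : w = 0.
  have [//|w_neq0] := eqVneq w 0; have wI := mulfI w_neq0.
  have q002_0 : q002 = 0 by apply: wI; lra.
  have q020_0 : q020 = 0 by apply: wI; nra.
  have q011_0 : q011 = 0 by apply: wI; nra.
  have q110_0 : q110 = 0 by apply: wI; nra.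
  have q101_0 : q101 = 0 by apply: wI; nra.
  by case: q_neq0; do !split => //; apply: wI; nra.
subst v w.
have u0 : u = 0.
  have [//|u_neq0] := eqVneq u 0; have uI := mulfI u_neq0.
  (* The rotation has eigenvalues i and -i on linear forms in y, z, and 0, 2i and -2i on quadratic
     ones. A nonzero u would have to be a root of 1 + u^2 or 4 + u^2, which are positive over an
     ordered field. *)
  have u2_neq0 : 1 + u ^+ 2 != 0 by rewrite gt_eqF // addr_gt0 ?exprn_even_gt0.
  have u4_neq0 : 4 + u ^+ 2 != 0 by rewrite gt_eqF // addr_gt0 ?exprn_even_gt0.
  have q200_0 : q200 = 0 by apply: uI; lra.
  have q110_0 : q110 = 0 by apply: (mulfI u2_neq0); nra.
  have q101_0 : q101 = 0 by rewrite e210 q110_0; ring.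
  have q002E : q002 = - q020 by apply: uI; lra.
  have q020_0 : q020 = 0 by apply: (mulfI u4_neq0); nra.
  by case: q_neq0; do !split => //; nra.
by subst u; do !split => //; lra.
Qed.

(** The branches on successors give 0 where a factor x, y or z cannot be split off. At literal
    exponents they reduce, leaving a linear form in the coefficients of [f]. *)
Lemma mcoeff_EM_field (R : realType) (s r c : R) f i j l :
  (EM_field s r c f)@_(mon3 i j l) =
    s * (if j is j'.+1 then f@_(mon3 i.+1 j' l) *+ i.+1 else 0)
    - s * (f@_(mon3 i j l) *+ i)
    + (r * (if i is i'.+1 then f@_(mon3 i' j.+1 l) *+ j.+1 else 0)
       - (if i is i'.+1 then if l is l'.+1 then f@_(mon3 i' j.+1 l') *+ j.+1
                             else 0 else 0)
       - f@_(mon3 i j l) *+ j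
       + c * (f@_(mon3 i j.+1 l) *+ j.+1))
    + ((if i is i'.+1 then if j is j'.+1 then f@_(mon3 i' j' l.+1) *+ l.+1
                           else 0 else 0)
       - f@_(mon3 i j l) *+ l).
Proof.
rewrite EM_fieldE !(mcoeffD, mcoeffN, mcoeffZ) !mcoeff3E.
case: i => [|i]; case: j => [|j]; case: l => [|l] /=;
  rewrite ?mcoeff3E ?mulr0n /=; reflexivity.
Qed.

Lemma mcoeff_cofactorM (R : realType) (f k : {mpoly R[3]}) i j l :
  (degree k <= 1)%N ->
  (k * f)@_(mon3 i j l) =
    k@_(mon3 1 0 0) * (if i is i'.+1 then f@_(mon3 i' j l) else 0)
    + k@_(mon3 0 1 0) * (if j is j'.+1 then f@_(mon3 i j' l) else 0)
    + k@_(mon3 0 0 1) * (if l is l'.+1 then f@_(mon3 i j l') else 0)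
    + k@_(mon3 0 0 0) * f@_(mon3 i j l).
Proof.
move=> k1; rewrite {1}(cofactor_linearE k1) !mulrDl -!scalerAl mul_mpolyC.
by rewrite !(mcoeffD, mcoeffZ) !mcoeff3E.
Qed.

(* The remaining equations for f = a (y^2 + z^2) + b x^2 + p x + q z + o and the
   constant cofactor t. *)
Lemma reduced_system (R : realFieldType) (s r c t a b p q o : R) :
  s != 0 \/ t != 0 -> ~ (b = 0 /\ a = 0) ->
  - (2 * s * b) = t * b ->
  - (2 * a) = t * a ->
  2 * s * b + 2 * r * a + q = 0 ->
  - (s * p) = t * p ->
  s * p + 2 * c * a = 0 ->
  - q = t * q ->
  0 = t * o ->
  [\/ [/\ s = 1 / 2, t = - 1, b != 0 & [/\ a = 0, p = 0, q = - b & o = 0]],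
      [/\ s = 2, r = 0, t = - 2, a != 0
        & [/\ b = 0, p = - (c * a), q = 0 & o = 0]],
      [/\ r = 0, c = 0, t = - 2, a != 0 & [/\ b = 0, p = 0, q = 0 & o = 0]] |
      [/\ s = 1, c = 0, t = - 2, a != 0
        & [/\ b = - (r * a), p = 0, q = 0 & o = 0]]].
Proof.
move=> st_neq0 ab_neq0 e200 e020 e110 e100 e010 e001 e000.
have [a0|a_neq0] := eqVneq a 0.
  subst a; have b_neq0 : b != 0 by apply/eqP => b0; apply: ab_neq0.
  have tE : t = - (2 * s) by apply: (mulIf b_neq0); lra.
  (* As t = -2s, a vanishing s would make t vanish too, which [st_neq0] forbids. *)
  subst t; have s_neq0 : s != 0.
    by case: st_neq0 => //; apply: contraNneq => ->; rewrite mulr0 oppr0.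
  have p0 : p = 0 by apply: (mulfI s_neq0); lra.
  have q_neq0 : q != 0.
    have -> : q = - 2 * (s * b) by lra.
    by rewrite !mulf_neq0 // oppr_eq0 pnatr_eq0.
  (* The coefficient of z reads -q = t q with t = -2s; cancelling q leaves 2s = 1. *)
  have sE : s = 1 / 2.
    have : 1 = 2 * s by apply: (mulIf q_neq0); lra.
    lra.
  apply: Or41; subst s; do !split => //; lra.
have tE : t = - 2 by apply: (mulIf a_neq0); lra.
subst t; have q0 : q = 0 by lra.
have o0 : o = 0 by lra.
(* With t = -2, a nonzero p forces s = 2 and a nonzero b forces s = 1, so both cannot be nonzero. If
   p = b = 0, then r = c = 0; the overlap s = 2, r = c = 0 therefore falls under the third case. *)
have [p0|p_neq0] := eqVneq p 0; last first.
  have sE : s = 2 by apply: (mulIf p_neq0); lra.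
  subst s; have b0 : b = 0 by lra.
  have r0 : r = 0 by subst b; apply: (mulIf a_neq0); lra.
  by apply: Or42; do !split => //; lra.
have c0 : c = 0 by subst p; apply: (mulIf a_neq0); lra.
have [b0|b_neq0] := eqVneq b 0.
  have r0 : r = 0 by subst b; apply: (mulIf a_neq0); lra.
  by apply: Or43.
have sE : s = 1 by apply: (mulIf b_neq0); lra.
by apply: Or44; subst s; do !split => //; lra.
Qed.

(** * Necessity: every invariant surface of degree two belongs to one of the families *)

Lemma EM_necessity (R : realType) (s r c : R) (f k : {mpoly R[3]}) :
  s != 0 \/ k != 0 ->
  degree f = 2%N -> invariant_surface_with_cofactor s r c f k ->
  exists2 a : R, a != 0 &
    [\/ [/\ s = 1 / 2, f = a *: (x_ ^+ 2 - z_) & k = - 1],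
        [/\ s = 2, r = 0, f = a *: (y_ ^+ 2 + z_ ^+ 2 - c *: x_) & k = - 2],
        [/\ r = 0, c = 0, f = a *: (y_ ^+ 2 + z_ ^+ 2) & k = - 2] |
        [/\ s = 1, c = 0, f = a *: (y_ ^+ 2 + z_ ^+ 2 - r *: x_ ^+ 2)
          & k = - 2]].
Proof.
move=> sk_neq0 deg_f [k1 Xf].
have f3 := degree_eq2_msize deg_f.
have f_gt2 i j l : (2 < i + j + l)%N -> f@_(mon3 i j l) = 0.
  by move=> gt2; apply: (msize_leP _ _ f3); rewrite mdeg_mon3.
have E i j l := etrans (esym (mcoeff_EM_field s r c f i j l))
  (etrans (congr1 (mcoeff (mon3 i j l)) Xf) (mcoeff_cofactorM f i j l k1)).
(* One rule for each of the ten cubic monomials: a monomial of degree at least 3 is divisible by one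
   of them. The successor patterns let all such coefficients be rewritten to 0 at once. *)
have f0 :
    (forall i j l, f@_(mon3 i.+3 j l) = 0) *
    (forall i j l, f@_(mon3 i j.+3 l) = 0) *
    (forall i j l, f@_(mon3 i j l.+3) = 0) *
    (forall i j l, f@_(mon3 i.+2 j.+1 l) = 0) *
    (forall i j l, f@_(mon3 i.+2 j l.+1) = 0) *
    (forall i j l, f@_(mon3 i.+1 j.+2 l) = 0) *
    (forall i j l, f@_(mon3 i j.+2 l.+1) = 0) *
    (forall i j l, f@_(mon3 i.+1 j l.+2) = 0) *
    (forall i j l, f@_(mon3 i j.+1 l.+2) = 0) *
    (forall i j l, f@_(mon3 i.+1 j.+1 l.+1) = 0).
  by do !split; move=> i j l; apply: f_gt2; lia.
move: (degree_eq2_neq0 deg_f) (msize_le3E f3) (cofactor_linearE k1).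
rewrite quadricE.
(* The ten cubic equations involve only the quadratic part of f and the linear part of k, and feed
   [rotation_eigenform]. The equations of lower degree follow. *)
move: (E 3 0 0)%N (E 0 3 0)%N (E 0 0 3)%N (E 2 1 0)%N (E 2 0 1)%N.
move: (E 1 2 0)%N (E 1 0 2)%N (E 0 2 1)%N (E 0 1 2)%N (E 1 1 1)%N.
move: (E 2 0 0)%N (E 0 2 0)%N (E 0 0 2)%N (E 1 1 0)%N (E 1 0 1)%N.
move: (E 1 0 0)%N (E 0 1 0)%N (E 0 0 1)%N (E 0 0 0)%N.
rewrite !f0 {E f0 f_gt2}.
move: (k@_(mon3 1 0 0)) (k@_(mon3 0 1 0)) (k@_(mon3 0 0 1)) (k@_(mon3 0 0 0)).
move: (f@_(mon3 2 0 0)) (f@_(mon3 0 2 0)) (f@_(mon3 0 0 2)) (f@_(mon3 1 1 0))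
  (f@_(mon3 1 0 1)) (f@_(mon3 0 1 1)) (f@_(mon3 1 0 0)) (f@_(mon3 0 1 0))
  (f@_(mon3 0 0 1)) (f@_(mon3 0 0 0)).
move=> q200 q020 q002 q110 q101 q011 q100 q010 q001 q000 u v w t.
move=> e100 e010 e001 e000 e200 e020 e002 e110 e101.
move=> e120 e102 e021 e012 e111 e300 e030 e003 e210 e201 q_neq0 fE kE.
case: (@rotation_eigenform R q200 q020 q002 q110 q101 q011 u v w q_neq0).
- by clear -e300; lra.
- by clear -e030; lra.
- by clear -e003; lra.
- by clear -e210; lra.
- by clear -e201; lra.
- by clear -e120; lra.
- by clear -e102; lra.
- by clear -e021; lra.
- by clear -e012; lra.
- by clear -e111; lra.
move=> u0 v0 w0 q002E [q110_0 q101_0 q011_0]; subst u v w q002 q110 q101 q011.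
have {}q_neq0 : ~ (q200 = 0 /\ q020 = 0).
  by move=> [q200_0 q020_0]; apply: q_neq0; do !split.
(* The field sends y to a polynomial containing -xz, so once the mixed terms and u, w are gone the
   coefficient of xz is -q010 = 0. *)
have q010_0 : q010 = 0 by clear -e101; lra.
have {}kE : k = t%:MP by rewrite kE !scale0r !add0r.
have {}sk_neq0 : s != 0 \/ t != 0 by move: sk_neq0; rewrite kE mpolyC_eq0.
subst q010; clear e300 e030 e003 e210 e201 e120 e102 e021 e012 e111 e101.
case: (@reduced_system R s r c t q020 q200 q100 q001 q000 sk_neq0 q_neq0).
- by clear -e200; lra.
- by clear -e020; lra.
- by clear -e110; lra.
- by clear -e100; lra.
- by clear -e010; lra.
- by clear -e001; lra.
- by clear -e000; lra.
- move=> [-> tE b_neq0 [a0 p0 qE o0]]; clear -fE kE tE b_neq0 a0 p0 qE o0.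
  (* In the first family the scalar is the coefficient of x^2, since y^2 and z^2 are absent; in the
     other three it is that of y^2. *)
  exists q200 => //; subst; apply: Or41.
  by split; rewrite ?mpolyCN // -!mul_mpolyC; ring.
- move=> [-> r0 tE a_neq0 [b0 pE q0 o0]]; clear -fE kE r0 tE a_neq0 b0 pE q0 o0.
  exists q020 => //; subst; apply: Or42.
  by split; rewrite ?mpolyCN ?mpolyCMn // -!mul_mpolyC; ring.
- move=> [r0 c0 tE a_neq0 [b0 pE q0 o0]].
  clear -fE kE r0 c0 tE a_neq0 b0 pE q0 o0.
  exists q020 => //; subst; apply: Or43.
  by split; rewrite ?mpolyCN ?mpolyCMn // -!mul_mpolyC; ring.
- move=> [-> c0 tE a_neq0 [bE pE q0 o0]]; clear -fE kE c0 tE a_neq0 bE pE q0 o0.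
  exists q020 => //; subst; apply: Or44.
  by split; rewrite ?mpolyCN ?mpolyCMn // -!mul_mpolyC; ring.
Qed.

(** * Sufficiency: verification of the four families *)

Lemma degree_mpolyC (R : realType) (t : R) : degree (t%:MP) = 0%N.
Proof. by rewrite /degree msizeC; case: eqP. Qed.

Lemma degree_quadric (R : realType)
    (q200 q020 q002 q110 q101 q011 q100 q010 q001 q000 : R) :
  q200 != 0 \/ q020 != 0 ->
  degree (quadric q200 q020 q002 q110 q101 q011 q100 q010 q001 q000) = 2%N.
Proof.
case=> q_neq0.
  by apply: (@degree_eq2 _ _ (mon3 2 0 0));
    rewrite ?msize_quadric_le ?mdeg_mon3 ?mcoeff_quadric.
by apply: (@degree_eq2 _ _ (mon3 0 2 0));
    rewrite ?msize_quadric_le ?mdeg_mon3 ?mcoeff_quadric.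
Qed.

(** The five free coefficients are those occurring in the four families, so a single differentiation
    serves all of them. *)
Lemma EM_field_quadric (R : realType) (s r c q200 q020 q002 q100 q001 : R) :
  EM_field s r c (quadric q200 q020 q002 0 0 0 q100 0 q001 0)
  = s *: (y_ - x_) * ((2 * q200) *: x_ + q100%:MP)
    + (r *: x_ - x_ * z_ - y_ + c%:MP) * ((2 * q020) *: y_)
    + (x_ * y_ - z_) * ((2 * q002) *: z_ + q001%:MP).
Proof.
rewrite quadricE !scale0r !addr0 /EM_field !expr2.
rewrite !(mderivD, mderivZ, mderivM) !mderivXi /=.
by rewrite -!mul_mpolyC; ring.
Qed.

Lemma EM_sufficiency (R : realType) (s r c : R) (f k : {mpoly R[3]}) (a : R) :
  a != 0 ->
    [\/ [/\ s = 1 / 2, f = a *: (x_ ^+ 2 - z_) & k = - 1],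
        [/\ s = 2, r = 0, f = a *: (y_ ^+ 2 + z_ ^+ 2 - c *: x_) & k = - 2],
        [/\ r = 0, c = 0, f = a *: (y_ ^+ 2 + z_ ^+ 2) & k = - 2] |
        [/\ s = 1, c = 0, f = a *: (y_ ^+ 2 + z_ ^+ 2 - r *: x_ ^+ 2)
          & k = - 2]] ->
  degree f = 2%N /\ invariant_surface_with_cofactor s r c f k.
Proof.
move=> a_neq0.
have k1 (t : R) : (degree (t%:MP : {mpoly R[3]}) <= 1)%N.
  by rewrite degree_mpolyC.
case.
- move=> [sE fE kE].
  have {}fE : f = quadric a 0 0 0 0 0 0 0 (- a) 0.
    by rewrite fE quadricE -!mul_mpolyC; ring.
  have {}kE : k = (-1)%:MP by rewrite kE mpolyCN.
  split; first by rewrite fE degree_quadric; [|left].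
  split; first by rewrite kE.
  (* The condition s = 1/2 is put in a division-free form in the polynomial ring, because X f - k f
     equals a x (y - x) (2s - 1). *)
  have sP : 2 * s%:MP_[3] = 1.
    by rewrite mulr_natl -mpolyCMn (_ : s *+ 2 = 1) // sE; field.
  rewrite kE fE EM_field_quadric quadricE -!mul_mpolyC.
  apply/subr0_eq; transitivity (a%:MP * x_ * (y_ - x_) * (2 * s%:MP_[3] - 1)).
    by ring.
  by rewrite sP subrr mulr0.
- move=> [-> -> fE kE].
  have {}fE : f = quadric 0 a a 0 0 0 (- (a * c)) 0 0 0.
    by rewrite fE quadricE -!mul_mpolyC; ring.
  have {}kE : k = (-2)%:MP by rewrite kE mpolyCN mpolyCMn.
  split; first by rewrite fE degree_quadric; [|right].
  split; first by rewrite kE.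
  by rewrite kE fE EM_field_quadric quadricE -!mul_mpolyC; ring.
- move=> [-> -> fE kE].
  have {}fE : f = quadric 0 a a 0 0 0 0 0 0 0.
    by rewrite fE quadricE -!mul_mpolyC; ring.
  have {}kE : k = (-2)%:MP by rewrite kE mpolyCN mpolyCMn.
  split; first by rewrite fE degree_quadric; [|right].
  split; first by rewrite kE.
  by rewrite kE fE EM_field_quadric quadricE -!mul_mpolyC; ring.
- move=> [-> -> fE kE].
  have {}fE : f = quadric (- (a * r)) a a 0 0 0 0 0 0 0.
    by rewrite fE quadricE -!mul_mpolyC; ring.
  have {}kE : k = (-2)%:MP by rewrite kE mpolyCN mpolyCMn.
  split; first by rewrite fE degree_quadric; [|right].
  split; first by rewrite kE.
  by rewrite kE fE EM_field_quadric quadricE -!mul_mpolyC; ring.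
Qed.

(* The hypothesis excludes exactly the trivial pairs s = 0, k = 0: for s = 0 the
   function x is a first integral, so every polynomial in x has cofactor 0. *)
Theorem theorem1 (R : realType) (s r c : R) (f k : {mpoly R[3]}) :
  s != 0 \/ k != 0 ->
  (degree f = 2%N /\ invariant_surface_with_cofactor s r c f k) <->
  (exists2 a : R, a != 0 &
    [\/ [/\ s = 1 / 2, f = a *: (x_ ^+ 2 - z_) & k = - 1],
        [/\ s = 2, r = 0, f = a *: (y_ ^+ 2 + z_ ^+ 2 - c *: x_) & k = - 2],
        [/\ r = 0, c = 0, f = a *: (y_ ^+ 2 + z_ ^+ 2) & k = - 2] |
        [/\ s = 1, c = 0, f = a *: (y_ ^+ 2 + z_ ^+ 2 - r *: x_ ^+ 2)
          & k = - 2]]).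
Proof.
move=> sk_neq0; split=> [[deg_f Xf]|[a a_neq0]]; first exact: EM_necessity Xf.
exact: EM_sufficiency.
Qed.
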